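(* Let $\mathcal{S}$ be a finite set and let $\nu$ and $\mu$ be Markov measures on a topologically-mixing SFT $X_A\subset\mathcal{S}^{\mathbb{Z}}$, with transition matrices $(P_n:n\in\mathbb{Z})$ and $(Q_n:n\in\mathbb{Z})$ respectively, both satisfying the Doeblin condition. Then $\nu\ll\mu$ if, and only if, $$\sum_{n\ge1}\sum_{s,u,v,t\in\mathcal{S}}\mathrm{d}_n^2[\nu,\mu](s,u,v,t)<\infty,$$ where for $n\ge1$ and $s,t,u,v\in\mathcal{S}$ $$\mathrm{d}_n^2[\nu,\mu](s,u,v,t):=\left(\sqrt{\widehat{P}_{-n}(u,s)P_n(v,t)}-\sqrt{\widehat{Q}_{-n}(u,s)Q_n(v,t)}\right)^2.$$ In particular, $\nu\ll\mu\iff\mu\ll\nu$, so that any two such measures are either equivalent or none of them is absolutely continuous with respect to the other.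
   Context: SFT: for a finite set $\mathcal{S}$ and a $\{0,1\}$-valued $\mathcal{S}\times\mathcal{S}$ matrix $A$, $X_A=\{x\in\mathcal{S}^{\mathbb{Z}}:A(x_n,x_{n+1})=1\ \forall n\in\mathbb{Z}\}$, with coordinate maps $X_n(x)=x_n$. $X_A$ is topologically-mixing if there is $M\ge1$ such that all entries of $A^M$ are positive. Markov measure: given row-stochastic $\mathcal{S}\times\mathcal{S}$ matrices $(P_n:n\in\mathbb{Z})$ with $P_n(s,t)=0$ whenever $A(s,t)=0$, and probability row vectors $(\pi_n:n\in\mathbb{Z})$ on $\mathcal{S}$ with $\pi_nP_n=\pi_{n+1}$ for all $n$, the associated Markov measure is the Borel probability measure $\nu$ on $X_A$ with $\nu(X_{k+1}=s_1,\dots,X_{k+m}=s_m)=\pi_{k+1}(s_1)P_{k+1}(s_1,s_2)\cdots P_{k+m-1}(s_{m-1},s_m)$ for all $k\in\mathbb{Z}$, $m\ge1$, $s_1,\dots,s_m\in\mathcal{S}$. Reverse transition matrices: $\widehat{P}_n(s,t)=\nu(X_{n-1}=t\mid X_n=s)=\frac{\pi_{n-1}(t)}{\pi_n(s)}P_{n-1}(t,s)$ if $\pi_n(s)>0$, and $\widehat{P}_n(s,t)=0$ if $\pi_n(s)=0$; $\widehat{Q}_n$ is defined in the same way from $\mu$. Doeblin condition (for the measure with transition matrices $P_n$): there exists $\delta>0$ such that for all $n\in\mathbb{Z}$ and $s,t\in\mathcal{S}$, $P_n(s,t)\ge\delta\iff A(s,t)=1$. Two measures are equivalent if each is absolutely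 continuous with respect to the other. *)

(* Defs.v *)
From HB Require Import structures.
From mathcomp Require Import all_boot all_order all_algebra.
From mathcomp Require Import all_classical all_reals all_analysis.

Set Implicit Arguments.
Unset Strict Implicit.
Unset Printing Implicit Defensive.

Import Order.TTheory GRing.Theory Num.Theory.

Local Open Scope classical_set_scope.
Local Open Scope ring_scope.

Definition full_shift (S : finType) : Type :=
  prod_topology (fun _ : int => discrete_topology S).

HB.instance Definition _ (S : finType) := Topological.on (full_shift S).

(* The 0-1 matrix is a boolean relation: [A s t] says that its entry at (s, t)
   is 1. *)
Definition sft_set (S : finType) (A : rel S) : set (full_shift S) :=
  [set x | forall n : int, A (x n) (x (n + 1))].

(* Measurable types are pointed in the library, so a proof that X_A is nonempty
   (which holds as soon as X_A carries a probability measure) is a parameter of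
   the type; the topology and the Borel sets do not depend on it. *)
Definition sft (S : finType) (A : rel S) (A0 : sft_set A !=set0) : Type :=
  set_type (sft_set A).

Section sft_instances.
Variables (S : finType) (A : rel S) (A0 : sft_set A !=set0).

HB.instance Definition _ := Topological.on (sft A0).
HB.instance Definition _ :=
  isPointed.Build (sft A0) (SigSub (mem_set (projT2 (cid A0)))).

Definition sft_borel : measurableType _ :=
  g_sigma_algebraType (@open (sft A0)).

Definition sft_coord (n : int) (x : sft_borel) : S :=
  (set_val (x : set_type (sft_set A)) : full_shift S) n.

End sft_instances.

(* Rows and columns are indexed through the enumeration of S. *)
Definition adj_mx (S : finType) (A : rel S) : 'M[nat]_#|S| :=
  \matrix_(i < #|S|, j < #|S|) nat_of_bool (A (enum_val i) (enum_val j)).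

Definition topologically_mixing (S : finType) (A : rel S) : Prop :=
  exists2 M : nat, (1 <= M)%N & forall i j, (0 < (adj_mx A ^+ M) i j)%N.

Definition stochastic_vector (R : realType) (S : finType) (p : S -> R) : Prop :=
  (forall s, 0 <= p s) /\ \sum_s p s = 1.

Definition stochastic_matrix (R : realType) (S : finType) (P : S -> S -> R) :
  Prop := forall s, stochastic_vector (P s).

Record is_markov_measure (R : realType) (S : finType) (A : rel S)
    (A0 : sft_set A !=set0) (P : int -> S -> S -> R) (pi : int -> S -> R)
    (nu : probability (sft_borel A0) R) : Prop := IsMarkovMeasure {
  markov_stochastic : forall n, stochastic_matrix (P n);
  markov_support : forall n s t, ~~ A s t -> P n s t = 0;
  markov_marginal : forall n, stochastic_vector (pi n);
  markov_invariant : forall n t, \sum_s pi n s * P n s t = pi (n + 1) t;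
  (* only the values s 1, ..., s m of the sequence s matter *)
  markov_cylinder : forall (k : int) (m : nat) (s : nat -> S), (1 <= m)%N ->
    nu [set x | forall i : nat, (1 <= i <= m)%N ->
                sft_coord (k + i%:Z) x = s i] =
    (pi (k + 1) (s 1%N) *
     \prod_(1 <= i < m) P (k + i%:Z) (s i) (s i.+1))%:E
}.

Definition doeblin (R : realType) (S : finType) (A : rel S)
    (P : int -> S -> S -> R) : Prop :=
  exists2 delta : R, 0 < delta &
    forall n s t, (delta <= P n s t) <-> A s t.

Definition reverse_transition (R : realType) (S : finType)
    (P : int -> S -> S -> R) (pi : int -> S -> R) (n : int) (s t : S) : R :=
  if 0 < pi n s then pi (n - 1) t / pi n s * P (n - 1) t s else 0.

Definition dsq (R : realType) (S : finType)
    (P : int -> S -> S -> R) (pi : int -> S -> R)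
    (Q : int -> S -> S -> R) (rho : int -> S -> R)
    (n : nat) (s u v t : S) : R :=
  (Num.sqrt (reverse_transition P pi (- n%:Z) u s * P n%:Z v t) -
   Num.sqrt (reverse_transition Q rho (- n%:Z) u s * Q n%:Z v t)) ^+ 2.

(* Main.v *)
Require Import Defs.
From mathcomp Require Import all_boot all_order all_algebra.
From mathcomp Require Import all_classical all_reals all_analysis.
From mathcomp Require Import ring lra zify.

(** View [x] through its windows [x_{-n}, ..., x_n]: enlarging a window by one
    coordinate on each side is a step of a Markov chain, governed by the
    transitions [P^_{-n}(u, s) P_n(v, t)] of the pair of ends.  Let [H_n] be the
    Hellinger affinity of the laws of the [n]-th window and [D_n] the [n]-th
    term of the series.

    By mixing and the Doeblin condition, every pair of ends carries a fixed
    proportion of [H_n], so [H_n - H_{n+1} >= c H_n D_n].  Hence if the series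
    diverges then [H_n] tends to [0], and cylinders separate [nu] from [mu].

    Conversely, compare [nu] with the measure that moves like [nu] up to time
    [N] and like [mu] afterwards.  The latter is bounded by [C_N mu], and its
    squared Hellinger distance to [nu] is at most [\sum_(n >= N) D_n].  So
    [nu E <= C mu E + e] for all cylinders [E], and by the monotone class theorem
    for all Borel sets.  Both criteria are symmetric in [nu] and [mu]. *)

Set Implicit Arguments.
Unset Strict Implicit.
Unset Printing Implicit Defensive.

Import Order.TTheory GRing.Theory Num.Theory.

Local Open Scope classical_set_scope.
Local Open Scope ring_scope.

(* A point of [window S n] is a word [x_{-n} ... x_n], built from the middle
   outwards. *)
Fixpoint window (S : finType) (n : nat) : finType :=
  if n is m.+1 then (S * window S m * S)%type else S.

Definition left_end (S : finType) n : window S n -> S :=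
  match n with 0 => fun w => w | _.+1 => fun w => w.1.1 end.

Definition right_end (S : finType) n : window S n -> S :=
  match n with 0 => fun w => w | _.+1 => fun w => w.2 end.

(** * Weights on windows *)

Section window_weight.
Variables (R : realType) (S : finType).
Implicit Types (f : S -> R) (p : nat -> S -> S -> S -> S -> R).

(* [p n u v s t] is the weight of prolonging a window of ends [(u, v)] at times
   [(-n, n)] by [(s, t)] at times [(-n-1, n+1)]. *)
Fixpoint weight f p n : window S n -> R :=
  match n with
  | 0 => fun w => f w
  | m.+1 => fun w => weight f p w.1.2 *
      p m (left_end w.1.2) (right_end w.1.2) w.1.1 w.2
  end.

(** The push-forward of [weight] to the pair of ends. It starts on the diagonal because a one-letter
    window has equal ends. *)
Fixpoint end_weight f p n : S -> S -> R :=
  if n is m.+1 then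
    fun s t => \sum_u \sum_v end_weight f p m u v * p m u v s t
  else fun s t => if s == t then f s else 0.

Lemma weight_ends f p n (F : S -> S -> R) :
  \sum_(w : window S n) weight f p w * F (left_end w) (right_end w) =
  \sum_s \sum_t end_weight f p n s t * F s t.
Proof.
elim: n F => [|n IH] F /=.
  apply: eq_bigr => s _; rewrite (bigD1 s)//= eqxx big1 ?addr0// => t ts.
  by rewrite eq_sym (negbTE ts) mul0r.
transitivity (\sum_s \sum_(w : window S n) \sum_t
    weight f p w * p n (left_end w) (right_end w) s t * F s t).
  have bij : bijective (fun x : S * (window S n * S) => ((x.1, x.2.1), x.2.2)).
    by exists (fun x => (x.1.1, (x.1.2, x.2))) => [[? []]|[[]]].
  rewrite (reindex _ (onW_bij _ bij))/=.
  by under [RHS]eq_bigr do rewrite pair_bigA/=; rewrite [RHS]pair_bigA/=.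
apply: eq_bigr => s _; rewrite exchange_big/=; apply: eq_bigr => t _.
rewrite -mulr_suml (IH (fun u v => p n u v s t)); congr (_ * _).
Qed.

Lemma sum_weightS f p n :
  \sum_(w : window S n.+1) weight f p w =
  \sum_(w : window S n) weight f p w *
    (\sum_s \sum_t p n (left_end w) (right_end w) s t).
Proof.
rewrite (weight_ends _ _ _ (fun u v => \sum_s \sum_t p n u v s t)).
have := weight_ends f p n.+1 (fun _ _ => 1).
under eq_bigr do rewrite mulr1; move=> ->.
transitivity (\sum_s \sum_t \sum_u \sum_v end_weight f p n u v * p n u v s t).
  by apply: eq_bigr => s _; apply: eq_bigr => t _; rewrite mulr1.
under eq_bigr do rewrite exchange_big/=.
rewrite exchange_big/=; apply: eq_bigr => u _.
under eq_bigr do rewrite exchange_big/=.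
rewrite exchange_big/=; apply: eq_bigr => v _.
rewrite mulr_sumr; apply: eq_bigr => s _; by rewrite mulr_sumr.
Qed.

Definition kernel_ge0 f p := (forall s, 0 <= f s) /\
  (forall n u v s t, 0 <= p n u v s t).

Lemma weight_ge0 f p n (w : window S n) : kernel_ge0 f p -> 0 <= weight f p w.
Proof.
by move=> [f0 p0]; elim: n w => [|n IH] w /=; rewrite ?f0// mulr_ge0// ?IH.
Qed.

Lemma end_weight_ge0 f p n s t : kernel_ge0 f p -> 0 <= end_weight f p n s t.
Proof.
move=> [f0 p0]; elim: n s t => [|n IH] s t /=; first by case: ifP.
by apply: sumr_ge0 => u _; apply: sumr_ge0 => v _; rewrite mulr_ge0.
Qed.

Definition kernel_stochastic f p := \sum_s f s = 1 /\
  (forall n u v, \sum_s \sum_t p n u v s t = 1).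

Lemma sum_weight1 f p n : kernel_stochastic f p ->
  \sum_(w : window S n) weight f p w = 1.
Proof.
move=> [f1 p1]; elim: n => [|n IH]; first exact: f1.
by rewrite sum_weightS -[RHS]IH; apply: eq_bigr => w _; rewrite p1 mulr1.
Qed.

Lemma weight_le f p f' p' (C : R) N n (w : window S n) :
  1 <= C -> kernel_ge0 f p -> kernel_ge0 f' p' ->
  (forall s, f s <= C * f' s) ->
  (forall m u v s t, (m < N)%N -> p m u v s t <= C * p' m u v s t) ->
  (forall m u v s t, (N <= m)%N -> p m u v s t = p' m u v s t) ->
  weight f p w <= C ^+ N.+1 * weight f' p' w.
Proof.
move=> C1 k k' ff' pp' ppN.
have C0 : 0 <= C by exact: le_trans C1.
(* The exponent stops growing at step [N]: one factor [C] for the initial weight and one for each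
   step before [N]. *)
suff H m (x : window S m) : weight f p x <= C ^+ (minn m N).+1 * weight f' p' x.
  apply: (le_trans (H _ w)); apply: ler_wpM2r; first exact: weight_ge0.
  by rewrite ler_weXn2l// ltnS geq_minr.
elim: m x => [|m IH] x /=; first by rewrite min0n expr1.
case: (ltnP m N) => mN.
  rewrite (minn_idPl mN) exprSr mulrACA; apply: ler_pM.
  - exact: weight_ge0.
  - exact: k.2.
  - by apply: (le_trans (IH _)); rewrite (minn_idPl (ltnW mN)).
  - exact: pp'.
rewrite mulrA (minn_idPr (leqW mN)) ppN//; apply: ler_wpM2r; first exact: k'.2.
by apply: (le_trans (IH _)); rewrite (minn_idPr mN).
Qed.

(** * Hellinger affinity of two laws on windows *)

Definition sqrt_init f g : S -> R := fun s => Num.sqrt (f s * g s).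
Definition sqrt_kernel p q : nat -> S -> S -> S -> S -> R :=
  fun n u v s t => Num.sqrt (p n u v s t * q n u v s t).

Lemma sqrt_kernel_ge0 f p g q :
  kernel_ge0 (sqrt_init f g) (sqrt_kernel p q).
Proof. by split => *; exact: sqrtr_ge0. Qed.

Lemma weight_sqrt f p g q n (w : window S n) :
  kernel_ge0 f p -> kernel_ge0 g q ->
  weight (sqrt_init f g) (sqrt_kernel p q) w =
  Num.sqrt (weight f p w * weight g q w).
Proof.
move=> k l; elim: n w => [|n IH] w //=.
rewrite IH -sqrtrM; last by rewrite mulr_ge0// weight_ge0.
by rewrite /sqrt_kernel mulrACA.
Qed.

(** By [weight_sqrt], for nonnegative kernels the summand is the square root of the product of the
    two weights. *)
Definition affinity f p g q n :=
  \sum_(w : window S n) weight (sqrt_init f g) (sqrt_kernel p q) w.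

Lemma affinity_ge0 f p g q n : 0 <= affinity f p g q n.
Proof. by apply: sumr_ge0 => w _; apply: weight_ge0; exact: sqrt_kernel_ge0. Qed.

Definition hellinger_sq p q n (u v : S) : R :=
  \sum_s \sum_t (Num.sqrt (p n u v s t) - Num.sqrt (q n u v s t)) ^+ 2.

Lemma hellinger_sq_ge0 p q n u v : 0 <= hellinger_sq p q n u v.
Proof. by do 2! apply: sumr_ge0 => ? _; exact: sqr_ge0. Qed.

Lemma sqrt_kernel_sum f p g q n u v :
  kernel_ge0 f p -> kernel_ge0 g q ->
  kernel_stochastic f p -> kernel_stochastic g q ->
  \sum_s \sum_t sqrt_kernel p q n u v s t = 1 - hellinger_sq p q n u v / 2.
Proof.
move=> [_ p0] [_ q0] [_ p1] [_ q1].
have -> : hellinger_sq p q n u v = \sum_s \sum_t p n u v s t +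
    \sum_s \sum_t q n u v s t - 2 * \sum_s \sum_t sqrt_kernel p q n u v s t.
  rewrite -big_split mulr_sumr -sumrB; apply: eq_bigr => s _.
  rewrite -big_split mulr_sumr -sumrB; apply: eq_bigr => t _.
  rewrite sqrrB !sqr_sqrtr// /sqrt_kernel sqrtrM//= -mulr_natl; ring.
by rewrite p1 q1; field.
Qed.

Lemma affinityS f p g q n :
  kernel_ge0 f p -> kernel_ge0 g q ->
  kernel_stochastic f p -> kernel_stochastic g q ->
  affinity f p g q n - affinity f p g q n.+1 =
  \sum_(w : window S n) weight (sqrt_init f g) (sqrt_kernel p q) w *
    (hellinger_sq p q n (left_end w) (right_end w) / 2).
Proof.
move=> kp kq sp sq; rewrite /affinity sum_weightS -sumrB.
by apply: eq_bigr => w _; rewrite (sqrt_kernel_sum _ _ _ kp kq)//; ring.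
Qed.

Lemma affinity_nonincreasing f p g q m n :
  kernel_ge0 f p -> kernel_ge0 g q ->
  kernel_stochastic f p -> kernel_stochastic g q ->
  (m <= n)%N -> affinity f p g q n <= affinity f p g q m.
Proof.
move=> kp kq sp sq; elim: n => [|n IH]; first by rewrite leqn0 => /eqP ->.
rewrite leq_eqVlt => /predU1P[->//|/IH]; apply: le_trans.
rewrite -subr_ge0 affinityS//; apply: sumr_ge0 => w _.
by rewrite mulr_ge0 ?divr_ge0 ?hellinger_sq_ge0//; exact/weight_ge0/sqrt_kernel_ge0.
Qed.

Lemma affinity_le1 f p g q n :
  kernel_ge0 f p -> kernel_ge0 g q ->
  kernel_stochastic f p -> kernel_stochastic g q -> affinity f p g q n <= 1.
Proof.
move=> kp kq sp sq; have a1 := sum_weight1 n sp; have b1 := sum_weight1 n sq.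
suff : affinity f p g q n <= \sum_(w : window S n) (weight f p w + weight g q w) / 2.
  by rewrite -mulr_suml big_split/= a1 b1; lra.
apply: ler_sum => w _; rewrite weight_sqrt//.
have := weight_ge0 w kp; have := weight_ge0 w kq.
move: (weight f p w) (weight g q w) => x y y0 x0.
have := sqr_ge0 (Num.sqrt x - Num.sqrt y).
by rewrite sqrrB !sqr_sqrtr// sqrtrM// -mulr_natl; lra.
Qed.

(** By [affinityS], step [n] loses at most [e n / 2] times the affinity, which is itself at most
    1. *)
Lemma affinity_ge f p g q (e : nat -> R) n :
  kernel_ge0 f p -> kernel_ge0 g q ->
  kernel_stochastic f p -> kernel_stochastic g q ->
  (forall m u v, hellinger_sq p q m u v <= e m) ->
  affinity f p g q 0 - (\sum_(0 <= m < n) e m) / 2 <= affinity f p g q n.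
Proof.
move=> kp kq sp sq he; elim: n => [|n IH]; first by rewrite big_geq// mul0r subr0.
rewrite big_nat_recr//=.
suff : affinity f p g q n - affinity f p g q n.+1 <= e n / 2 by lra.
rewrite affinityS//.
apply: (@le_trans _ _ (affinity f p g q n * (e n / 2))).
  rewrite mulr_suml; apply: ler_sum => w _.
  apply: ler_wpM2l; first exact/weight_ge0/sqrt_kernel_ge0.
  by rewrite ler_pM2r// invr_gt0.
have [w0|] := pselect (exists w : window S n, True).
  rewrite ler_piMl//; last exact: affinity_le1.
  case: w0 => w _; rewrite divr_ge0//.
  exact: le_trans (hellinger_sq_ge0 _ _ _ _ _) (he n (left_end w) (right_end w)).
move=> nw; exfalso; have := sum_weight1 n sp; rewrite big1 => [/esym/eqP|w _].
  by rewrite oner_eq0.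
by exfalso; apply: nw; exists w.
Qed.

End window_weight.

(** * Kernels satisfying the Doeblin condition *)

Section reach.
Variables (S : finType) (A : rel S).

(** Entries of the [k]-th power count walks of length [k], so this is the existence of such a walk
    from [s] to [t]. *)
Definition reach k (s t : S) : bool :=
  (0 < (adj_mx A ^+ k)%R (enum_rank s) (enum_rank t))%N.

Lemma reach0 s t : reach 0 s t -> s = t.
Proof.
rewrite /reach expr0 mxE; case: eqVneq => [/enum_rank_inj//|_].
by rewrite mulr0n.
Qed.

Lemma sumn_gt0_exists (I : finType) (F : I -> nat) :
  (0 < (\sum_i F i)%R)%N -> exists i, (0 < F i)%N.
Proof.
move=> F0; apply/existsP; move: F0; apply: contraTT => /existsPn F0.
by rewrite -eqn0Ngt; apply/eqP/big1 => i _; apply/eqP; rewrite eqn0Ngt F0.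
Qed.

Lemma reachS k s t : reach k.+1 s t -> exists2 u, A s u & reach k u t.
Proof.
rewrite /reach exprS mxE => /sumn_gt0_exists[i]; rewrite muln_gt0 => /andP[+ h].
rewrite mxE enum_rankK => Ai; exists (enum_val i); last by rewrite enum_valK.
by case: (A _ _) Ai.
Qed.

Lemma reachSr k s t : reach k.+1 s t -> exists2 u, A u t & reach k s u.
Proof.
rewrite /reach exprSr mxE => /sumn_gt0_exists[i]; rewrite muln_gt0 => /andP[h].
rewrite mxE enum_rankK => Ai; exists (enum_val i); last by rewrite enum_valK.
by case: (A _ _) Ai.
Qed.

Lemma mixing_reach : topologically_mixing A -> exists M, forall s t, reach M s t.
Proof. by case=> M _ h; exists M => s t; exact: h. Qed.

End reach.

Section doeblin_kernel.
Variables (R : realType) (S : finType) (A : rel S).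
Implicit Types (f g : S -> R) (p q : nat -> S -> S -> S -> S -> R).

Record doeblin_kernel (k : R) f p : Prop := DoeblinKernel {
  doeblin_init : forall s, k <= f s;
  doeblin_on : forall n u v s t, A s u -> A v t -> k <= p n u v s t;
  doeblin_off : forall n u v s t, ~~ (A s u && A v t) -> p n u v s t = 0;
  doeblin_stoch : kernel_stochastic f p
}.

Lemma doeblin_kernel_ge0 (k : R) f p : 0 <= k ->
  doeblin_kernel k f p -> kernel_ge0 f p.
Proof.
move=> k0 [fk pk p0 _]; split=> [s|n u v s t]; first exact: le_trans (fk s).
case: (boolP (A s u && A v t)) => [/andP[su vt]|h]; last by rewrite p0.
exact: le_trans (pk _ _ _ _ _ su vt).
Qed.

(** Both kernels vanish off the same transitions; on these [p] is at most 1, being part of a total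
    mass 1, and [q] is at least [k]. *)
Lemma doeblin_kernel_comparable (k : R) f p g q : 0 < k ->
  doeblin_kernel k f p -> doeblin_kernel k g q ->
  (forall s, f s <= k^-1 * g s) /\
  (forall n u v s t, p n u v s t <= k^-1 * q n u v s t).
Proof.
move=> k0 dp dq; have [f0 p0] := doeblin_kernel_ge0 (ltW k0) dp.
have [sf sp] := doeblin_stoch dp.
split=> [s|n u v s t].
  apply: (@le_trans _ _ 1).
    by rewrite -sf (bigD1 s)//= lerDl sumr_ge0.
  by rewrite ler_pdivlMl// mulr1 (doeblin_init dq).
case: (boolP (A s u && A v t)) => [/andP[su vt]|h]; last first.
  by rewrite (doeblin_off dp)// (doeblin_off dq)// mulr0.
apply: (@le_trans _ _ 1).
  rewrite -(sp n u v) (bigD1 s)//= (bigD1 t)//= -addrA lerDl addr_ge0//.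
    exact: sumr_ge0.
  by apply: sumr_ge0 => ? _; exact: sumr_ge0.
by rewrite ler_pdivlMl// mulr1 (doeblin_on dq).
Qed.

Definition total_hellinger p q n : R := \sum_u \sum_v hellinger_sq p q n u v.

Lemma hellinger_sq_le_total p q n u v : hellinger_sq p q n u v <= total_hellinger p q n.
Proof.
rewrite /total_hellinger (bigD1 u)//= (bigD1 v)//= -addrA lerDl addr_ge0//.
  by apply: sumr_ge0 => ? _; exact: hellinger_sq_ge0.
by do 2!apply: sumr_ge0 => ? _; exact: hellinger_sq_ge0.
Qed.

Lemma total_hellinger_ge0 p q n : 0 <= total_hellinger p q n.
Proof. by do 2!apply: sumr_ge0 => ? _; exact: hellinger_sq_ge0. Qed.

(** * Affinity and domination for two Doeblin kernels *)

Section two_kernels.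
Variables (k : R) (f g : S -> R) (p q : nat -> S -> S -> S -> S -> R).
Hypotheses (k0 : 0 < k) (dp : doeblin_kernel k f p) (dq : doeblin_kernel k g q).

Let p0 := doeblin_kernel_ge0 (ltW k0) dp.
Let q0 := doeblin_kernel_ge0 (ltW k0) dq.
Let p1 := doeblin_stoch dp.
Let q1 := doeblin_stoch dq.
Local Notation aff := (affinity f p g q).
Local Notation ew := (end_weight (sqrt_init f g) (sqrt_kernel p q)).
Local Notation D := (total_hellinger p q).

Lemma affinity_end_weight n : aff n = \sum_u \sum_v ew n u v.
Proof.
have := weight_ends (sqrt_init f g) (sqrt_kernel p q) n (fun _ _ => 1).
under eq_bigr do rewrite mulr1.
rewrite /affinity => ->; apply: eq_bigr => u _; apply: eq_bigr => v _.
exact: mulr1.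
Qed.

Lemma end_weight_reach m n s t u v :
  reach A m s u -> reach A m v t -> k ^+ m * ew n u v <= ew (n + m) s t.
Proof.
elim: m s t => [|m IH] s t.
  by move=> /reach0 -> /reach0 ->; rewrite expr0 mul1r addn0.
move=> /reachS[a sa au] /reachSr[b bt vb]; rewrite addnS/=.
have e0 i j l : 0 <= ew i j l by exact/end_weight_ge0/sqrt_kernel_ge0.
have h0 i j j' l l' : 0 <= sqrt_kernel p q i j j' l l' by exact: sqrtr_ge0.
apply: (@le_trans _ _ (ew (n + m) a b * sqrt_kernel p q (n + m) a b s t)).
  rewrite exprSr mulrAC; apply: ler_pM => //.
  - by rewrite mulr_ge0// exprn_ge0// ltW.
  - exact: ltW.
  - exact: IH.
  rewrite -[leLHS]gtr0_norm// -sqrtr_sqr ler_wsqrtr// expr2.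
  by apply: ler_pM; rewrite ?(ltW k0) ?(doeblin_on dp) ?(doeblin_on dq).
rewrite (bigD1 a)//= (bigD1 b)//= -addrA lerDl addr_ge0//.
  by apply: sumr_ge0 => ? _; rewrite mulr_ge0.
by do 2!apply: sumr_ge0 => ? _; rewrite mulr_ge0.
Qed.

Lemma affinity_le_end_weight M n s t : (forall u v, reach A M u v) ->
  k ^+ M * aff n <= #|S|%:R ^+ 2 * ew (n + M) s t.
Proof.
move=> AM; rewrite affinity_end_weight.
have -> : #|S|%:R ^+ 2 * ew (n + M) s t = \sum_(u : S) \sum_(v : S) ew (n + M) s t.
  by rewrite !sumr_const -mulrnA -[RHS]mulr_natl expr2 -natrM.
rewrite mulr_sumr; apply: ler_sum => u _; rewrite mulr_sumr.
by apply: ler_sum => v _; exact: end_weight_reach.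
Qed.

(** After [M] more steps each pair of ends carries a fixed share of [aff n], hence of the smaller
    [aff (n + M)]; inserted in [affinityS], this bounds the loss from below. *)
Lemma affinity_drop M n : (forall u v, reach A M u v) ->
  k ^+ M * (aff (n + M) * D (n + M)) <=
  2 * #|S|%:R ^+ 2 * (aff (n + M) - aff (n + M).+1).
Proof.
move=> AM; rewrite affinityS//.
rewrite (weight_ends _ _ _ (fun u v => hellinger_sq p q (n + M) u v / 2)).
rewrite /total_hellinger !mulr_sumr; apply: ler_sum => u _.
rewrite !mulr_sumr; apply: ler_sum => v _.
have := affinity_le_end_weight n u v AM.
have an : aff (n + M) <= aff n by apply: affinity_nonincreasing => //; exact: leq_addr.
move/(le_trans (ler_wpM2l (exprn_ge0 M (ltW k0)) an)).
move=> /(ler_wpM2r (hellinger_sq_ge0 p q (n + M) u v)).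
move: (hellinger_sq _ _ _ _ _) (ew _ _ _) (aff _) => x y z.
rewrite !mulrA => /le_trans; apply; rewrite le_eqVlt; apply/orP; left; apply/eqP.
by field.
Qed.

(** The bound of [affinity_drop] telescopes: the total loss of affinity is at most 1, and the lower
    bound [eta] is divided out. *)
Lemma total_hellinger_summable M (eta : R) : (forall u v, reach A M u v) ->
  0 < eta -> (forall n, eta <= aff n) ->
  exists B : R, forall n, \sum_(0 <= i < n) D (i + M) <= B.
Proof.
move=> AM eta0 Heta; exists (2 * #|S|%:R ^+ 2 / (k ^+ M * eta)) => n.
rewrite ler_pdivlMr ?mulr_gt0// ?exprn_gt0//.
have c0 : 0 <= 2 * #|S|%:R ^+ 2 :> R by rewrite mulr_ge0// exprn_ge0.
suff : (\sum_(0 <= i < n) D (i + M)) * (k ^+ M * eta) <=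
    2 * #|S|%:R ^+ 2 * (aff M - aff (n + M)).
  move/le_trans; apply; rewrite ler_piMr//.
  have := affinity_le1 M p0 q0 p1 q1; have := affinity_ge0 f p g q (n + M); lra.
elim: n => [|n IH]; first by rewrite big_geq// mul0r add0n subrr mulr0.
rewrite big_nat_recr//= mulrDl.
have H1 : D (n + M) * (k ^+ M * eta) <= k ^+ M * (aff (n + M) * D (n + M)).
  rewrite mulrC -mulrA; apply: ler_wpM2l; first by rewrite exprn_ge0// ltW.
  by apply: ler_wpM2r; [exact: total_hellinger_ge0|exact: Heta].
have := affinity_drop n AM; rewrite addSn; lra.
Qed.

Definition hybrid N : nat -> S -> S -> S -> S -> R :=
  fun m => if (m < N)%N then p m else q m.

(** The hybrid weight is at most [k^-1 ^+ N.+1] times the second weight, and its squared Hellinger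
    distance to the first is at most [eps]. The factors 2 come from [a^2 <= 2 b^2 + 2 (a - b)^2]. *)
Lemma weight_dominated (eps : R) N :
  (forall n, \sum_(N <= i < n) D i <= eps) ->
  exists2 C : R, 0 <= C & forall n (B : pred (window S n)),
    \sum_(w | B w) weight f p w <=
    C * \sum_(w | B w) weight g q w + 2 * eps.
Proof.
move=> Deps; have eps0 : 0 <= eps by have := Deps N; rewrite big_geq.
pose h := hybrid N.
have h0 : kernel_ge0 f h.
  split=> [|n u v s t]; first exact: p0.1.
  by rewrite /h/hybrid; case: ifP => _; [exact: p0.2|exact: q0.2].
have h1 : kernel_stochastic f h.
  split=> [|n u v]; first exact: p1.1.
  by rewrite /h/hybrid; case: ifP => _; [exact: p1.2|exact: q1.2].
have [fg pq] := doeblin_kernel_comparable k0 dp dq.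
(* Without letters there are no windows. With a letter [s], [k <= f s <= 1] gives [1 <= k^-1]. *)
have [s0|] := pselect (exists s : S, True); last first.
  move=> nS; exists 0 => // n B; rewrite big1; first by rewrite mul0r add0r mulr_ge0.
  by move=> w _; exfalso; apply: nS; exists (left_end w).
have k1 : 1 <= k^-1.
  rewrite invf_ge1//; have [s _] := s0; apply: (le_trans (doeblin_init dp s)).
  by rewrite -p1.1 (bigD1 s)//= lerDl sumr_ge0// => ? _; exact: p0.1.
exists (2 * k^-1 ^+ N.+1) => [|n B].
  by rewrite mulr_ge0// exprn_ge0// invr_ge0 ltW.
have hg (w : window S n) : weight f h w <= k^-1 ^+ N.+1 * weight g q w.
  apply: weight_le => // m u v s t mN; rewrite /h /hybrid; first by rewrite mN.
  by rewrite ltnNge mN.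
have aff_ge : 1 - eps / 2 <= affinity f p f h n.
  (* Before step [N] the kernels [p] and [h] coincide, so affinity is lost only from step [N] on. *)
  have := @affinity_ge R S f p f h (fun m => if (m < N)%N then 0 else D m) n p0 h0 p1 h1.
  have -> : affinity f p f h 0 = 1.
    rewrite /affinity/= -p1.1; apply: eq_bigr => s _.
    by rewrite /sqrt_init -expr2 sqrtr_sqr ger0_norm//; exact: p0.1.
  have H : \sum_(0 <= m < n) (if (m < N)%N then 0 else D m) <= eps.
    rewrite (@big_cat_nat _ _ _ (minn n N))//= ?geq_minl//.
    rewrite big_nat_cond big1 ?add0r => [|i]; last first.
      by rewrite andbT leq0n/= leq_min => /andP[_ ->].
    case: (leqP n N) => [nN|Nn]; first by rewrite big_geq.
    rewrite big_nat_cond (eq_bigr D) -?big_nat_cond => // i.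
    by rewrite andbT => /andP[Ni _]; rewrite ltnNge Ni.
  have H' m u v : hellinger_sq p h m u v <= if (m < N)%N then 0 else D m.
    rewrite /h /hellinger_sq /hybrid; case: ifP => mN.
      by rewrite big1// => s _; rewrite big1// => t _; rewrite subrr expr0n.
    exact: hellinger_sq_le_total.
  by move=> /(_ H'); lra.
have Hsq (w : window S n) : weight f p w <=
    2 * weight f h w + 2 * (Num.sqrt (weight f p w) - Num.sqrt (weight f h w)) ^+ 2.
  have := weight_ge0 w p0; have := weight_ge0 w h0.
  move: (weight f p w) (weight f h w) => x y y0' x0'.
  (* with [a, b] the square roots: [2 b^2 + 2 (a - b)^2 - a^2 = (a - 2 b)^2] *)
  rewrite -{1}(sqr_sqrtr x0') -{1}(sqr_sqrtr y0').
  have := sqr_ge0 (Num.sqrt x - 2 * Num.sqrt y); nra.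
have Hsum : \sum_(w : window S n)
    (Num.sqrt (weight f p w) - Num.sqrt (weight f h w)) ^+ 2 =
    2 - 2 * affinity f p f h n.
  rewrite /affinity mulr_sumr.
  have two : \sum_(w : window S n) (weight f p w + weight f h w) = 2.
    by rewrite big_split/= !sum_weight1.
  rewrite -[X in _ = X - _]two -sumrB; apply: eq_bigr => w _; rewrite weight_sqrt//.
  rewrite sqrrB !sqr_sqrtr ?weight_ge0// sqrtrM ?weight_ge0// -mulr_natl.
  by ring.
apply: (@le_trans _ _ (\sum_(w | B w) (2 * k^-1 ^+ N.+1 * weight g q w) +
   2 * \sum_(w : window S n)
    (Num.sqrt (weight f p w) - Num.sqrt (weight f h w)) ^+ 2)).
  rewrite [X in _ <= _ + 2 * X](bigID B)/= mulrDr addrA.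
  apply: ler_wpDr; first by rewrite mulr_ge0// sumr_ge0// => ? _; exact: sqr_ge0.
  rewrite mulr_sumr -big_split/=; apply: ler_sum => w _.
  apply: (le_trans (Hsq w)); rewrite lerD2r -mulrA ler_pM2l//.
rewrite -mulr_sumr lerD2l Hsum; lra.
Qed.

End two_kernels.
End doeblin_kernel.

(** * The window laws of a Markov measure *)

Fixpoint window_of (S : finType) n (x : int -> S) : window S n :=
  match n with
  | 0 => x 0
  | m.+1 => (x (- m.+1%:Z), window_of m x, x m.+1%:Z)
  end.

(** Outside [[-n, n]] the path takes the middle letter as a default value. *)
Fixpoint window_path (S : finType) n : window S n -> int -> S :=
  match n with
  | 0 => fun w _ => w
  | m.+1 => fun w i => if i == m.+1%:Z then w.2
                       else if i == - m.+1%:Z then w.1.1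
                       else window_path w.1.2 i
  end.

Section window_path.
Variable S : finType.

Lemma window_ofP n (x : int -> S) (w : window S n) :
  window_of n x = w <->
  (forall i : int, - n%:Z <= i <= n%:Z -> x i = window_path w i).
Proof.
elim: n w => [|n IH] w /=.
  split=> [<- i|->//]; rewrite oppr0 => i0.
  by congr x; apply/eqP; rewrite eq_le andbC.
case: w => [[s w] t]; split=> /= [[<- <- <-] i|h].
  case: eqP => [->//|ni]; case: eqP => [->//|ni'] ib.
  by apply: (IH _).1 => //; lia.
have -> : window_of n x = w.
  apply/IH => i ib; rewrite h; last by lia.
  by rewrite !ifF//; apply/eqP; lia.
have := h n.+1%:Z; rewrite eqxx => ->; last by lia.
have -> : x (- n.+1%:Z) = s; last by [].
rewrite h; last by lia.
by rewrite eqxx; case: eqP => // ?; lia.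
Qed.

Lemma window_path_left n (w : window S n) :
  window_path w (- n%:Z) = left_end w.
Proof. by case: n w => [|n] w//=; rewrite eqxx. Qed.

Lemma window_path_right n (w : window S n) :
  window_path w n%:Z = right_end w.
Proof. by case: n w => [|n] w//=; rewrite eqxx. Qed.

Lemma window_path_mid n (w : window S n.+1) (i : int) :
  - n%:Z <= i <= n%:Z -> window_path w i = window_path w.1.2 i.
Proof. by move=> ib /=; rewrite !ifF//; apply/eqP; lia. Qed.

End window_path.

(** By the Markov property the two new letters are independent given the window: a backward step
    from the left end and a forward step from the right end. *)
Definition markov_kernel (R : realType) (S : finType) (P : int -> S -> S -> R)
    (pi : int -> S -> R) : nat -> S -> S -> S -> S -> R :=
  fun n u v s t => reverse_transition P pi (- n%:Z) u s * P n%:Z v t.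

Section markov_kernel.
Variables (R : realType) (S : finType) (A : rel S) (A0 : sft_set A !=set0).
Variables (P : int -> S -> S -> R) (pi : int -> S -> R).
Variable nu : probability (sft_borel A0) R.
Hypotheses (mixA : topologically_mixing A) (mP : is_markov_measure P pi nu).
Hypothesis (dP : doeblin A P).

Let P_ge0 n s t : 0 <= P n s t.
Proof. exact: (markov_stochastic mP n s).1. Qed.

Let pi_ge0 n s : 0 <= pi n s.
Proof. exact: (markov_marginal mP n).1. Qed.

Lemma marginal_reach (d : R) k n s t : 0 <= d ->
  (forall n s t, A s t -> d <= P n s t) ->
  reach A k s t -> d ^+ k * pi n s <= pi (n + k%:Z) t.
Proof.
move=> d0 Pd; elim: k t => [|k IH] t.
  by move=> /reach0 ->; rewrite expr0 mul1r addr0.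
move=> /reachSr[u Aut su]; rewrite intS addrCA addrC.
rewrite -(markov_invariant mP) (bigD1 u)//=.
apply: (@le_trans _ _ (pi (n + k%:Z) u * P (n + k%:Z) u t)).
  by rewrite exprSr mulrAC; apply: ler_pM; rewrite ?mulr_ge0 ?exprn_ge0 ?IH ?Pd.
by rewrite lerDl sumr_ge0// => i _; rewrite mulr_ge0.
Qed.

(** By mixing, [t] is reached in [M] steps from every state at time [n - M]; the bounds of
    [marginal_reach] are summed over the starting states. *)
Lemma marginal_bounded_below : exists2 c : R, 0 < c & forall n s, c <= pi n s.
Proof.
have [M AM] := mixing_reach mixA; have [d d0 Pd] := dP.
have S0 : (0 < #|S|)%N.
  by have [x _] := A0; apply/card_gt0P; exists (x 0).
exists (d ^+ M / #|S|%:R) => [|n t].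
  by rewrite divr_gt0 ?exprn_gt0// ltr0n.
rewrite ler_pdivrMr ?ltr0n//.
have -> : d ^+ M = \sum_s d ^+ M * pi (n - M%:Z) s.
  by rewrite -mulr_sumr (markov_marginal mP _).2 mulr1.
rewrite mulr_natr -sumr_const; apply: ler_sum => s _.
rewrite -{2}(subrK M%:Z n); apply: marginal_reach => //; first exact: ltW.
by move=> *; apply/Pd.
Qed.

(** The marginals are positive, so the default value 0 never occurs. *)
Lemma reverse_transitionE n s t : reverse_transition P pi n s t =
  pi (n - 1) t / pi n s * P (n - 1) t s.
Proof.
have [c c0 cpi] := marginal_bounded_below.
by rewrite /reverse_transition (lt_le_trans c0 (cpi _ _)).
Qed.

Lemma markov_doeblin_kernel :
  exists2 k : R, 0 < k & doeblin_kernel A k (pi 0) (markov_kernel P pi).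
Proof.
have [c c0 cpi] := marginal_bounded_below; have [d d0 Pd] := dP.
have pi0 n s : 0 < pi n s by exact: lt_le_trans (cpi n s).
have pi_le1 n s : pi n s <= 1.
  by rewrite -(markov_marginal mP n).2 (bigD1 s)//= lerDl sumr_ge0.
(* The marginals lie between [c] and 1, so their quotients are at least [c]; the backward and the
   forward transition each contribute a [d]. *)
exists (Num.min c (c * d * d)); first by rewrite lt_min c0 !mulr_gt0.
split => [s|n u v s t Asu Avt|n u v s t|].
- by rewrite ge_min cpi.
- rewrite ge_min; apply/orP; right; apply: ler_pM.
  + by rewrite mulr_ge0// ltW.
  + exact: ltW.
  + rewrite reverse_transitionE; apply: ler_pM; rewrite ?(ltW c0) ?(ltW d0)//.
      apply: (le_trans (cpi (- n%:Z - 1) s)).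
      by rewrite ler_pdivlMr// ler_piMr.
    exact/Pd.
  + exact/Pd.
- rewrite negb_and /markov_kernel reverse_transitionE.
  by case/orP => /(markov_support mP) ->; rewrite ?mulr0 ?mul0r.
split=> [|n u v]; first exact: (markov_marginal mP 0).2.
under eq_bigr do rewrite -mulr_sumr (markov_stochastic mP _ _).2 mulr1.
under eq_bigr do rewrite reverse_transitionE mulrAC.
rewrite -mulr_suml (markov_invariant mP) subrK divff//.
by rewrite gt_eqF.
Qed.

(** Each backward factor trades the marginal at the old left end for the one at the new left end
    times a forward transition. So the weight built from the middle becomes the cylinder formula
    read from left to right. *)
Lemma weight_path n (w : window S n) : weight (pi 0) (markov_kernel P pi) w =
  pi (- n%:Z) (window_path w (- n%:Z)) *
  \prod_(1 <= i < n.*2.+1) P (- n%:Z - 1 + i%:Z)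
     (window_path w (- n%:Z - 1 + i%:Z)) (window_path w (- n%:Z - 1 + i.+1%:Z)).
Proof.
have [c c0 cpi] := marginal_bounded_below.
elim: n w => [|n IH] w; first by rewrite big_geq// mulr1 oppr0.
rewrite doubleS big_nat_recr// big_ltn// big_add1 succnK.
rewrite [weight _ _ w]/= IH /markov_kernel reverse_transitionE.
have -> : \prod_(1 <= i < n.*2.+1) P (- n.+1%:Z - 1 + i.+1%:Z)
     (window_path w (- n.+1%:Z - 1 + i.+1%:Z))
     (window_path w (- n.+1%:Z - 1 + i.+2%:Z)) =
   \prod_(1 <= i < n.*2.+1) P (- n%:Z - 1 + i%:Z)
     (window_path w.1.2 (- n%:Z - 1 + i%:Z))
     (window_path w.1.2 (- n%:Z - 1 + i.+1%:Z)).
  rewrite big_nat_cond [RHS]big_nat_cond; apply: eq_bigr => i.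
  rewrite andbT => ib.
  have -> : - n.+1%:Z - 1 + i.+1%:Z = - n%:Z - 1 + i%:Z by lia.
  have -> : - n.+1%:Z - 1 + i.+2%:Z = - n%:Z - 1 + i.+1%:Z by lia.
  by rewrite !window_path_mid//; lia.
have -> : - n.+1%:Z - 1 + 1%:Z = - n.+1%:Z by lia.
have -> : - n.+1%:Z - 1 + 2%:Z = - n%:Z by lia.
have -> : - n.+1%:Z - 1 + n.*2.+2%:Z = n%:Z by lia.
have -> : - n.+1%:Z - 1 + n.*2.+3%:Z = n.+1%:Z by lia.
have -> : - n%:Z - 1 = - n.+1%:Z by lia.
rewrite [window_path w (- n.+1%:Z)]window_path_left.
rewrite [window_path w n.+1%:Z]window_path_right.
rewrite !(@window_path_mid _ n w) ?window_path_left ?window_path_right; [|lia|lia].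
have p0 : pi (- n%:Z) (left_end w.1.2) != 0.
  by rewrite gt_eqF// (lt_le_trans c0).
by move: (\prod_(1 <= i < _) _) => x /=; field.
Qed.

Lemma markov_window n (w : window S n) :
  nu [set x | window_of n (fun i => sft_coord i x) = w] =
  (weight (pi 0) (markov_kernel P pi) w)%:E.
Proof.
rewrite weight_path.
(* The cylinder formula covers times [k + 1] to [k + m]; here [k = - n - 1] and [m = 2 n + 1], which
   gives [- n] to [n]. *)
have := @markov_cylinder _ _ _ _ _ _ _ mP (- n%:Z - 1) n.*2.+1
  (fun i => window_path w (- n%:Z - 1 + i%:Z)) isT.
rewrite subrK => <-; congr (nu _); apply/seteqP; split=> x /=.
  by move/window_ofP => h i ib; rewrite h//; lia.
move=> h; apply/window_ofP => i ib.
have := h (absz (i + n%:Z + 1)).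
have -> : (absz (i + n%:Z + 1))%:Z = i + n%:Z + 1 by lia.
have -> : - n%:Z - 1 + (i + n%:Z + 1) = i by lia.
apply; lia.
Qed.

End markov_kernel.

(** * Cylinders generate the Borel sets *)

Section cylinders.
Variables (S : finType) (A : rel S) (A0 : sft_set A !=set0).
Local Notation X := (sft_borel A0).

Definition central_window n (x : X) : window S n :=
  window_of n (fun i => sft_coord i x).

Definition window_cylinder n (B : pred (window S n)) : set X :=
  [set x | B (central_window n x)].

Definition cylinders : set (set X) :=
  [set E | exists n (B : pred (window S n)), E = window_cylinder B].

Lemma full_shift_coord_open (n : int) (s : S) :
  open [set x : full_shift S | x n = s].
Proof.
have c : continuous (fun x : full_shift S => x n : discrete_topology S).
  exact: (@proj_continuous int (fun=> discrete_topology S) n).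
have h := (continuousP _).1 c; exact: (h [set s] (discrete_open _)).
Qed.

Lemma sft_coord_open (n : int) (s : S) :
  open [set x : sft A0 | sft_coord n (x : X) = s].
Proof.
by exists [set x : full_shift S | x n = s] => //; exact: full_shift_coord_open.
Qed.

Lemma central_window_open n (w : window S n) :
  open ([set x | central_window n x = w] : set (sft A0)).
Proof.
elim: n w => [|n IH] w; first exact: sft_coord_open.
have -> : [set x | central_window n.+1 x = w] =
    [set x | sft_coord (- n.+1%:Z) x = w.1.1] `&`
    [set x | central_window n x = w.1.2] `&`
    [set x | sft_coord n.+1%:Z x = w.2].
  case: w => [[s w] t]; apply/seteqP; split=> x /=.
    by case=> *.
  by case=> [[<- <-] <-].
by apply: openI; [apply: openI|]; [exact: sft_coord_open|exact: IH|exact: sft_coord_open].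
Qed.

Lemma window_cylinderE n (B : pred (window S n)) :
  window_cylinder B = \bigcup_(w in [set w | B w]) [set x | central_window n x = w].
Proof.
apply/seteqP; split=> x; first by move=> Bx; exists (central_window n x).
by case=> w Bw xw; rewrite /window_cylinder /= xw.
Qed.

Lemma window_cylinder_measurable n (B : pred (window S n)) :
  measurable (window_cylinder B).
Proof.
apply: sub_sigma_algebra; rewrite window_cylinderE.
by apply: bigcup_open => w _; exact: central_window_open.
Qed.

Lemma central_window_coord n (x y : X) (i : int) : (absz i <= n)%N ->
  central_window n x = central_window n y -> sft_coord i x = sft_coord i y.
Proof.
move=> inn xy; have /window_ofP -> := xy; last by lia.
by have /window_ofP <- := erefl (central_window n y); last by lia.
Qed.

(** Otherwise points outside [U] agree with [x] on ever longer windows; they converge to [x]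
    coordinatewise, against the openness of [U]. *)
Lemma sft_open_nbhs (U : set (sft A0)) (x : X) : open U -> U x ->
  exists n, forall y : X, central_window n y = central_window n x -> U y.
Proof.
move=> [W oW <-] Wx; apply: contrapT => /forallNP h.
have /choice[y yP] : forall n, exists y : X,
    central_window n y = central_window n x /\ ~ W (set_val (y : set_type (sft_set A))).
  by move=> n; have /existsNP[y /not_implyP[]] := h n; exists y.
pose v (z : X) : full_shift S := set_val (z : set_type (sft_set A)).
have cvg_y : (v \o y) @ \oo --> v x.
  apply/cvg_sup => i Z [V [[T oT <-] /= Tx] VZ].
  exists (absz i) => // n /= ni; apply: VZ => /=.
  by have := central_window_coord ni (yP n).1; rewrite /sft_coord /v => ->.
have /cvg_y[n _ /(_ n (leqnn n))] : nbhs (v x) W by exact: open_nbhs_nbhs.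
exact: (yP n).2.
Qed.

(** A window determines the shorter ones inside it; this brings two cylinders to a common length. *)
Lemma cylinders_lift (E : set X) : cylinders E ->
  exists N, forall n, (N <= n)%N -> exists B : pred (window S n), E = window_cylinder B.
Proof.
move=> [N [B EB]]; exists N; elim=> [|n IH].
  by rewrite leqn0 => /eqP N0; subst N; exists B.
rewrite leq_eqVlt => /predU1P[Nn|]; first by subst N; exists B.
by rewrite ltnS => /IH[C ->]; exists (fun w : window S n.+1 => C w.1.2).
Qed.

Lemma cylinders_setring : setring cylinders.
Proof.
have lift2 (E F : set X) : cylinders E -> cylinders F ->
    exists n (B C : pred (window S n)),
    E = window_cylinder B /\ F = window_cylinder C.
  move=> /cylinders_lift[N HE] /cylinders_lift[M HF]; exists (maxn N M).
  have [B ->] := HE _ (leq_maxl N M); have [C ->] := HF _ (leq_maxr N M).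
  by exists B, C.
split.
- by exists 0%N, pred0; apply/seteqP; split.
- move=> E F /lift2 h /h[n [B [C [-> ->]]]]; exists n, (predU B C).
  apply/seteqP; split=> x /=; rewrite /window_cylinder/= => /orP; exact.
- move=> E F /lift2 h /h[n [B [C [-> ->]]]]; exists n, (predD B C).
  apply/seteqP; split=> x /=; rewrite /window_cylinder/=.
    by move=> [Bx /negP Cx]; apply/andP.
  by move=> /andP[/negP].
Qed.

Lemma measurable_g_cylinders (E : set X) : measurable E -> <<sr cylinders>> E.
Proof.
have [sr0 srD srU] := smallest_sigma_ring cylinders.
apply: smallest_sub.
  (* The whole space is a cylinder, so complements are differences and the sigma-ring is a
     sigma-algebra. *)
  split=> // F srF; apply: srD => //; apply: sub_g_sigma_ring.
  by exists 0%N, predT; apply/seteqP; split.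
move=> U oU.
(* The words whose cylinder lies in [U]; by [sft_open_nbhs] these cylinders exhaust [U]. *)
pose B n : pred (window S n) :=
  fun w => `[< [set x : X | central_window n x = w] `<=` U >].
have -> : U = \bigcup_n window_cylinder (B n).
  apply/seteqP; split=> [x Ux|x [n _ /asboolP]]; last exact.
  have [n Hn] := sft_open_nbhs oU Ux; exists n => //.
  by apply/asboolP => y; exact: Hn.
by apply: srU => n; apply: sub_g_sigma_ring; exists n, (B n).
Qed.

Lemma measure_window_cylinder (R : realType) (nu : probability X R) n
    (F : window S n -> R) (B : pred (window S n)) :
  (forall w, nu [set x | central_window n x = w] = (F w)%:E) ->
  nu (window_cylinder B) = (\sum_(w | B w) F w)%:E.
Proof.
move=> nuF; rewrite window_cylinderE.
have -> : [set w | B w] = [set` enum B].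
  by apply/seteqP; split=> w /=; rewrite mem_enum.
rewrite measure_fin_bigcup//=.
- rewrite -fsbig_seq ?enum_uniq// big_enum -sumEFin.
  by apply: eq_bigr => w _; exact: nuF.
- by move=> w1 w2 _ _ [x [/= <- <-]].
- by move=> w _; apply: sub_sigma_algebra; exact: central_window_open.
Qed.

End cylinders.

(** * Absolute continuity *)

(** Viewed as a charge, [nu] has a variation that bounds it and is continuous with respect to
    [mu]. *)
Lemma probability_dominates_continuous d (T : measurableType d) (R : realType)
    (nu mu : probability T R) (e : R) : nu `<< mu -> 0 < e ->
  exists2 r : R, 0 < r &
    forall E, measurable E -> (mu E < r%:E -> nu E < e%:E)%E.
Proof.
move=> numu e0; pose c : {charge set T -> \bar R} := charge_of_finite_measure nu.
have [P [N PN]] := Hahn_decomposition c.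
have [r [r0 rP]] := charge_variation_continuous PN (numu : c `<< mu) e0.
exists r => // E mE /(rP E mE); apply: le_lt_trans.
have := abse_charge_variation PN mE.
by rewrite gee0_abs//; exact: measure_ge0.
Qed.

(** * Series of nonnegative terms *)

Section series.
Variable R : realType.
Implicit Type D : nat -> R.

Lemma nneseries_ltyP D : (forall n, 0 <= D n) ->
  (\sum_(1 <= n <oo) (D n)%:E < +oo)%E <->
  exists B : R, forall n, \sum_(0 <= i < n) D i <= B.
Proof.
move=> D0; split=> [lty|[B DB]].
  (* The partial sums start at index 0 and the series at 1, hence the extra term [D 0]. *)
  exists (D 0%N + fine (\sum_(1 <= n <oo) (D n)%:E)%E) => n.
  have D1 m : \sum_(1 <= i < m) D i <= fine (\sum_(1 <= n <oo) (D n)%:E)%E.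
    rewrite -lee_fin fineK; last first.
      by rewrite ge0_fin_numE// nneseries_ge0// => i _ _; rewrite lee_fin.
    rewrite -sumEFin; apply: nneseries_lim_ge => i _ _; by rewrite lee_fin.
  case: n => [|n]; last by rewrite big_ltn// lerD2l.
  rewrite big_geq// addr_ge0//.
  by have := D1 1%N; rewrite big_geq.
apply: (@le_lt_trans _ _ B%:E); last exact: ltry.
apply: lime_le; first by apply: is_cvg_nneseries => i _ _; rewrite lee_fin.
apply: nearW => n; rewrite sumEFin lee_fin.
apply: le_trans (DB n); case: n => [|n]; first by rewrite !big_geq.
by rewrite [leRHS]big_ltn// lerDr.
Qed.

(** [N] is an index at which the partial sum is within [e] of the supremum. *)
Lemma bounded_series_tail D (e : R) : (forall n, 0 <= D n) -> 0 < e ->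
  (exists B : R, forall n, \sum_(0 <= i < n) D i <= B) ->
  exists N, forall n, \sum_(N <= i < n) D i <= e.
Proof.
move=> D0 e0 [B DB]; pose u n := \sum_(0 <= i < n) D i.
have us : has_sup (range u).
  split; first by exists (u 0%N); exists 0%N.
  by exists B => _ [n _ <-]; exact: DB.
have [_ [N _ <-] uN] := sup_adherent e0 us; exists N => n.
case: (leqP N n) => Nn; last by rewrite big_geq ?ltW// ltnW.
have : u n <= sup (range u) by apply: sup_upper_bound => //; exists n.
rewrite {1}/u (@big_cat_nat _ _ _ N)//= -/(u N); lra.
Qed.

End series.

Section absolute_continuity.
Variables (R : realType) (S : finType) (A : rel S) (A0 : sft_set A !=set0).
Local Notation X := (sft_borel A0).
Implicit Types nu mu : probability X R.

(** Finite measures are continuous along increasing and decreasing sequences, and the inequality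
    passes to the limit. *)
Lemma cylinder_bound_monotone nu mu (C e : R) :
  monotone [set E : set X | measurable E /\ (nu E <= C%:E * mu E + e%:E)%E].
Proof.
have lim (F : (set X)^nat) (L : set X) :
    (nu \o F @ \oo --> nu L)%E -> (mu \o F @ \oo --> mu L)%E ->
    (forall n, nu (F n) <= C%:E * mu (F n) + e%:E)%E ->
    (nu L <= C%:E * mu L + e%:E)%E.
  move=> nF mF H.
  have cF : ((fun n => C%:E * mu (F n) + e%:E) @ \oo --> C%:E * mu L + e%:E)%E.
    apply: cvgeD; [by rewrite fin_num_adde_defl| |exact: cvg_cst].
    exact: cvgeZl.
  rewrite -(cvg_lim _ nF)// -(cvg_lim _ cF)//; apply: lee_lim.
  - by apply/cvg_ex; exists (nu L).
  - by apply/cvg_ex; eexists; exact: cF.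
  - exact: nearW.
split=> F mono GF.
  have mL : measurable (\bigcup_n F n) by apply: bigcupT_measurable => n; exact: (GF n).1.
  split=> //; apply: (lim F) => [||n]; last exact: (GF n).2.
    by apply: nondecreasing_cvg_mu => // n; exact: (GF n).1.
  by apply: nondecreasing_cvg_mu => // n; exact: (GF n).1.
have mL : measurable (\bigcap_n F n) by apply: bigcapT_measurable => n; exact: (GF n).1.
split=> //; apply: (lim F) => [||n]; last exact: (GF n).2.
  apply: nonincreasing_cvg_mu => // [|n]; last exact: (GF n).1.
  by rewrite -ge0_fin_numE// fin_num_measure//; exact: (GF 0%N).1.
apply: nonincreasing_cvg_mu => // [|n]; last exact: (GF n).1.
by rewrite -ge0_fin_numE// fin_num_measure//; exact: (GF 0%N).1.
Qed.

(** On a [mu]-null set the term with [C] vanishes and the bound is [e], which is arbitrary even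
    though [C] depends on it. *)
Lemma dominates_of_cylinders nu mu :
  (forall e : R, 0 < e -> exists C : R, forall n (B : pred (window S n)),
     (nu (window_cylinder B) <= C%:E * mu (window_cylinder B) + e%:E)%E) ->
  nu `<< mu.
Proof.
move=> H; apply/null_content_dominatesP => E mE muE.
apply/eqP; rewrite eq_le measure_ge0 andbT; apply/lee_addgt0Pr => e e0.
have [C HC] := H _ e0.
have := @monotone_setring_sub_g_sigma_ring _ _ _
  (cylinder_bound_monotone nu mu C e) (cylinders_setring A0).
move=> /(_ _ E (measurable_g_cylinders mE))[].
  move=> _ [n [B ->]]; split; [exact: window_cylinder_measurable|exact: HC].
by move=> _; rewrite [mu E]muE mule0.
Qed.

Section two_markov.
Variables (nu mu : probability X R) (k : R).
Variables (f g : S -> R) (p q : nat -> S -> S -> S -> S -> R).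
Hypotheses (mixA : topologically_mixing A) (k0 : 0 < k).
Hypotheses (dp : doeblin_kernel A k f p) (dq : doeblin_kernel A k g q).
Hypothesis nuE : forall n (w : window S n),
  nu [set x | central_window n x = w] = (weight f p w)%:E.
Hypothesis muE : forall n (w : window S n),
  mu [set x | central_window n x = w] = (weight g q w)%:E.

Let p0 := doeblin_kernel_ge0 (ltW k0) dp.
Let q0 := doeblin_kernel_ge0 (ltW k0) dq.
Let p1 := doeblin_stoch dp.
Let q1 := doeblin_stoch dq.

(** Let [B] be the event that the [mu]-weight is at most the [nu]-weight. As
    [min(a, b) <= sqrt(a b)], the affinity bounds both [mu B] and the [nu]-mass of the complement.
    Were it too small, absolute continuity would give [nu B < 1/2], and the complement would also
    have [nu]-mass below 1/2. *)
Lemma dominates_affinity : nu `<< mu ->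
  exists2 eta : R, 0 < eta & forall n, eta <= affinity f p g q n.
Proof.
move=> /probability_dominates_continuous.
have half0 : (0 : R) < 2^-1 by rewrite invr_gt0.
move=> /(_ _ half0)[r r0 Hr]; exists (Num.min r 2^-1) => [|n].
  by rewrite lt_min r0.
rewrite leNgt; apply/negP; rewrite lt_min => /andP[affr aff2].
have a0 w : 0 <= weight (n := n) f p w by exact: weight_ge0.
have b0 w : 0 <= weight (n := n) g q w by exact: weight_ge0.
have affE : affinity f p g q n =
    \sum_(w : window S n) Num.sqrt (weight f p w * weight g q w).
  by apply: eq_bigr => w _; exact: weight_sqrt.
pose B : pred (window S n) := fun w => weight g q w <= weight f p w.
have muB : \sum_(w | B w) weight g q w <= affinity f p g q n.
  rewrite affE [leRHS](bigID B)/=; apply: ler_wpDr.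
    by apply: sumr_ge0 => w _; exact: sqrtr_ge0.
  apply: ler_sum => w Bw; rewrite -[leLHS]ger0_norm// -sqrtr_sqr expr2.
  by rewrite ler_wsqrtr// ler_wpM2r.
have nuB : \sum_(w | ~~ B w) weight f p w <= affinity f p g q n.
  rewrite affE [leRHS](bigID (predC B))/=; apply: ler_wpDr.
    by apply: sumr_ge0 => w _; exact: sqrtr_ge0.
  apply: ler_sum => w Bw; rewrite -[leLHS]ger0_norm// -sqrtr_sqr expr2.
  by rewrite ler_wsqrtr// ler_wpM2l// ltW// ltNge.
have := Hr _ (@window_cylinder_measurable _ _ A0 _ B).
rewrite (measure_window_cylinder _ (nuE (n := n))).
rewrite (measure_window_cylinder _ (muE (n := n))) !lte_fin.
move=> /(_ (le_lt_trans muB affr)).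
have := sum_weight1 n p1; rewrite (bigID B)/=; lra.
Qed.

Lemma dominates_summable : nu `<< mu <->
  exists B : R, forall n, \sum_(0 <= i < n) total_hellinger p q i <= B.
Proof.
split.
  move=> /dominates_affinity[eta eta0 Heta]; have [M AM] := mixing_reach mixA.
  have [B HB] := total_hellinger_summable k0 dp dq AM eta0 Heta.
  (* The telescoped bound starts at index [M]; the first [M] terms are added by hand. *)
  exists (\sum_(0 <= i < M) total_hellinger p q i + B) => n.
  apply: (@le_trans _ _ (\sum_(0 <= i < M + n) total_hellinger p q i)).
    rewrite [leRHS](@big_cat_nat _ _ _ n)//= ?leq_addl// lerDl.
    by apply: sumr_ge0 => i _; exact: total_hellinger_ge0.
  rewrite (@big_cat_nat _ _ _ M)//= ?leq_addr// lerD2l.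
  by rewrite -{1}[M]add0n big_addn addKn.
move=> /bounded_series_tail H; apply: dominates_of_cylinders => e e0.
(* Half of [e], because [weight_dominated] has the error [2 * eps]. *)
have e20 : 0 < e / 2 by rewrite divr_gt0.
have [N HN] := H _ (total_hellinger_ge0 p q) e20.
have [C C0 HC] := weight_dominated k0 dp dq HN.
exists C => n B; rewrite !(measure_window_cylinder _ (nuE (n := n))).
rewrite (measure_window_cylinder _ (muE (n := n))) -EFinM -EFinD lee_fin.
by have := HC n B; rewrite mulrCA divff// mulr1.
Qed.

End two_markov.
End absolute_continuity.

(** * The criterion for Markov measures *)

Lemma doeblin_kernel_le (R : realType) (S : finType) (A : rel S) (k k' : R) f p :
  k' <= k -> doeblin_kernel A k f p -> doeblin_kernel A k' f p.
Proof.
move=> kk [fk pk p0 p1]; split=> // [s|n u v s t su vt].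
  exact: le_trans (fk s).
exact: le_trans (pk _ _ _ _ _ su vt).
Qed.

Lemma total_hellinger_sym (R : realType) (S : finType)
    (p q : nat -> S -> S -> S -> S -> R) n :
  total_hellinger p q n = total_hellinger q p n.
Proof.
apply: eq_bigr => u _; apply: eq_bigr => v _.
apply: eq_bigr => s _; apply: eq_bigr => t _.
by rewrite -sqrrN opprB.
Qed.

Lemma total_hellinger_dsq (R : realType) (S : finType) (P Q : int -> S -> S -> R)
    (pi rho : int -> S -> R) n :
  total_hellinger (markov_kernel P pi) (markov_kernel Q rho) n =
  \sum_s \sum_u \sum_v \sum_t dsq P pi Q rho n s u v t.
Proof.
rewrite [RHS]exchange_big/=; apply: eq_bigr => u _.
by rewrite [RHS]exchange_big.
Qed.

Theorem theorem5p2 (R : realType) (S : finType) (A : rel S)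
    (A0 : sft_set A !=set0)
    (P Q : int -> S -> S -> R) (pi rho : int -> S -> R)
    (nu mu : probability (sft_borel A0) R) :
  topologically_mixing A ->
  is_markov_measure P pi nu -> is_markov_measure Q rho mu ->
  doeblin A P -> doeblin A Q ->
  [/\ nu `<< mu <->
        (\sum_(1 <= n <oo)
           (\sum_s \sum_u \sum_v \sum_t dsq P pi Q rho n s u v t)%:E < +oo)%E,
      nu `<< mu <-> mu `<< nu
    & (nu `<< mu /\ mu `<< nu) \/ (~ nu `<< mu /\ ~ mu `<< nu)].
Proof.
move=> mixA mP mQ dP dQ.
have [kP kP0 dkP] := markov_doeblin_kernel mixA mP dP.
have [kQ kQ0 dkQ] := markov_doeblin_kernel mixA mQ dQ.
(* The comparison of the two kernels requires a common Doeblin constant. *)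
have k0 : 0 < Num.min kP kQ by rewrite lt_min kP0.
have {}dkP : doeblin_kernel A (Num.min kP kQ) (pi 0) (markov_kernel P pi).
  by apply: doeblin_kernel_le dkP; rewrite ge_min lexx.
have {}dkQ : doeblin_kernel A (Num.min kP kQ) (rho 0) (markov_kernel Q rho).
  by apply: doeblin_kernel_le dkQ; rewrite ge_min lexx orbT.
have nuE := @markov_window _ _ _ _ _ _ _ mixA mP dP.
have muE := @markov_window _ _ _ _ _ _ _ mixA mQ dQ.
have numuP := dominates_summable mixA k0 dkP dkQ nuE muE.
have munuP := dominates_summable mixA k0 dkQ dkP muE nuE.
have equiv : nu `<< mu <-> mu `<< nu.
  rewrite numuP munuP.
  by split=> -[B DB]; exists B => n; apply: le_trans (DB n);
    apply: ler_sum => i _; rewrite total_hellinger_sym.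
split=> //.
  rewrite numuP -nneseries_ltyP; last by move=> n; exact: total_hellinger_ge0.
  by under eq_eseriesr do rewrite total_hellinger_dsq.
by have [|] := pselect (nu `<< mu) => h; [left|right]; split=> //; rewrite -equiv.
Qed.
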